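(* For every $m,n,\lambda\in\mathbb{N}$ and each $\mu\in\{0,\dots,\lambda\}$: if $m\ne n$, then $$OP_{K_{m,n},\operatorname{Aut}(K_{m,n})}(\lambda,\mu)=\frac{1}{m!\,n!}\sum_{k=0}^{m}\sum_{l=0}^{n}\left[{m\atop k}\right]\left[{n\atop l}\right]P_{K_{k,l}}(\lambda,\mu);$$ and $$OP_{K_{n,n},\operatorname{Aut}(K_{n,n})}(\lambda,\mu)=\frac{1}{2\cdot n!\cdot n!}\sum_{k,l=0}^{n}\left[{n\atop k}\right]\left[{n\atop l}\right]P_{K_{k,l}}(\lambda,\mu)+\frac12\binom{n+\lambda-\mu-1}{n},$$ where $P_{K_{k,l}}(\lambda,\mu)$ is given by $$P_{K_{k,l}}(\lambda,\mu)=\sum_{i=0}^{k}\binom{k}{i}(\lambda-\mu)^{k-i}\sum_{j=0}^{i}\left\{{i\atop j}\right\}(\lambda-j)^{l}\,\mu^{\underline{j}}.$$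
   Context: $\mathbb{N}$ denotes the positive integers. $K_{m,n}$ is the complete bipartite graph on $m+n$ vertices with parts of sizes $m$ and $n$. $\operatorname{Aut}(\Gamma)$ is the automorphism group of a graph $\Gamma$, viewed as a group of permutations of the vertices. A $\lambda$-coloring of $\Gamma$ is a map $f$ from the vertex set of $\Gamma$ to $\{1,\dots,\lambda\}$; it is $\mu$-proper if for every pair of adjacent vertices $v,w$, either $f(v)\ne f(w)$ or $f(v)=f(w)>\mu$. $P_\Gamma(\lambda,\mu)$ is the number of $\mu$-proper $\lambda$-colorings of $\Gamma$. For a subgroup $G$ of $\operatorname{Aut}(\Gamma)$, $OP_{\Gamma,G}(\lambda,\mu)$ is the number of equivalence classes of $\mu$-proper $\lambda$-colorings of $\Gamma$, where $f$ and $f'$ are equivalent if $f'=f\circ g$ for some $g\in G$. $\left[{n\atop k}\right]$ denotes the unsigned Stirling numbers of the first kind (number of permutations of $n$ elements with exactly $k$ cycles), $\left\{{i\atop j}\right\}$ the Stirling numbers of the second kind, and $x^{\underline{k}}=x(x-1)\cdots(x-k+1)$ the falling factorial. Convention: $0^0=1$. *)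

(* Defs.v *)
From mathcomp Require Import all_boot all_order all_algebra all_fingroup.

Set Implicit Arguments.
Unset Strict Implicit.
Unset Printing Implicit Defensive.

Record sgraph := SGraph {
  vertex :> finType;
  adj : rel vertex;
  adj_sym : symmetric adj;
  adj_irr : irreflexive adj
}.

Section Graph.
Variable Gamma : sgraph.

Definition graph_aut : {set {perm Gamma}} :=
  [set g : {perm Gamma} | [forall v, forall w, adj (g v) (g w) == adj v w]].

Lemma graph_aut_group_set : group_set graph_aut.
Proof.
apply/group_setP; split=> [|g h].
  by rewrite inE; apply/forallP=> v; apply/forallP=> w; rewrite !perm1.
rewrite !inE => /forallP Hg /forallP Hh.
apply/forallP=> v; apply/forallP=> w; rewrite !permM.
by rewrite (eqP (forallP (Hh _) _)) (eqP (forallP (Hg _) _)).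
Qed.

Canonical graph_aut_group := Group graph_aut_group_set.

(* The set of colors {1, ..., lambda} is represented by 'I_lambda, the ordinal
   c standing for the color c.+1. *)
Definition coloring (lambda : nat) := {ffun Gamma -> 'I_lambda}.

Definition color_of (lambda : nat) (c : 'I_lambda) : nat := c.+1.

Definition mu_proper (lambda mu : nat) (f : coloring lambda) : bool :=
  [forall v, forall w, adj v w ==>
     ((f v != f w) || ((f v == f w) && (mu < color_of (f v))))].

Definition mu_proper_colorings (lambda mu : nat) : {set coloring lambda} :=
  [set f | mu_proper mu f].

Definition bichrom (lambda mu : nat) : nat := #|mu_proper_colorings lambda mu|.

Definition color_equiv (G : {group {perm Gamma}}) (lambda : nat) :
    rel (coloring lambda) :=
  fun f f' => [exists g in G, f' == [ffun v => f (g v)]].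

(* Meaningful when G \subset graph_aut: color_equiv G is then an equivalence
   relation that preserves mu-properness. *)
Definition orbital_bichrom (G : {group {perm Gamma}}) (lambda mu : nat) : nat :=
  #|equivalence_partition (@color_equiv G lambda)
      (mu_proper_colorings lambda mu)|.

End Graph.

Section CompleteBipartite.
Variables m n : nat.

Definition Kadj : rel ('I_m + 'I_n)%type := fun x y =>
  match x, y with
  | inl _, inr _ | inr _, inl _ => true
  | _, _ => false
  end.

Lemma Kadj_sym : symmetric Kadj.
Proof. by case=> ? [] ?. Qed.

Lemma Kadj_irr : irreflexive Kadj.
Proof. by case. Qed.

Definition complete_bipartite : sgraph := SGraph Kadj_sym Kadj_irr.

End CompleteBipartite.

Definition stirling1 (n k : nat) : nat :=
  #|[set s : {perm 'I_n} | #|porbits s| == k]|.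

(* Blocks of a partition are nonempty, so stirling2 0 0 = 1. *)
Definition stirling2 (n k : nat) : nat :=
  #|[set P : {set {set 'I_n}} | partition P [set: 'I_n] && (#|P| == k)]|.

(* Main.v *)
(** Burnside's lemma reduces orbit counting to counting the mu-proper colorings
    fixed by each automorphism.  An automorphism of K_{m,n} is either a pair
    (a, b) of permutations of the two parts, or (only if m = n) such a pair
    followed by the exchange of the parts.  Colorings fixed by (a, b) are the
    colorings of K_{k,l}, with k and l the numbers of cycles of a and b; grouping
    pairs by cycle numbers gives the Stirling sum.  A coloring fixed by an
    exchanging automorphism uses the same colors on both parts, so it is proper
    iff all its colors exceed mu, and it is then a function on the cycles of the
    product a * b; summing (lambda - mu) ^ (number of cycles) over the symmetric
    group counts, by Burnside again, multisets of n colors.  For K_{k,l} itself,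
    sum over the coloring f of the left part: the right part must avoid the
    colors <= mu used by f, and f is classified by the set A of vertices with
    color <= mu and by the partition of A into color classes. *)

Require Import Defs.
From mathcomp Require Import all_boot all_order all_algebra all_fingroup.

Set Implicit Arguments.
Unset Strict Implicit.
Unset Printing Implicit Defensive.
Import GRing.Theory.

(** * Burnside's lemma for precomposition, and functions on quotients *)

Section Precomposition.
Variables T C : finType.
Implicit Types (f : {ffun T -> C}) (g : {perm T}).

(** The inverse makes this a right action, because a product of permutations applies its left factor
    first. *)
Definition precomp f g : {ffun T -> C} := [ffun v => f (g^-1%g v)].

Lemma precomp1 : precomp^~ 1%g =1 id.
Proof. by move=> f; apply/ffunP=> v; rewrite ffunE invg1 perm1. Qed.

Lemma precompM f : act_morph precomp f.
Proof. by move=> g h; apply/ffunP=> v; rewrite !ffunE invMg permM. Qed.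

Definition precomp_action := TotalAction precomp1 precompM.

Definition fixed_by g f := [forall v, f (g v) == f v].

Lemma fixed_byP g f : reflect (forall v, f (g v) = f v) (fixed_by g f).
Proof. by apply: (iffP forallP) => fP v; apply/eqP. Qed.

Lemma fixed_by_porbit g f x y :
  fixed_by g f -> porbit g x = porbit g y -> f x = f y.
Proof.
move=> /fixed_byP fg /eqP; rewrite eq_porbit_mem => /porbitP[i ->].
by elim: i y => [|i IHi] y; rewrite ?perm1 // expgSr permM fg.
Qed.

(** This is the Cauchy-Frobenius formula for [precomp_action]. The inverse in that action is
    harmless: [f] is fixed by [g] iff it is fixed by its inverse, and [G] is closed under inverses,
    so the orbits are the classes on the right-hand side. *)
Lemma burnside_precomp (G : {group {perm T}}) (S : {set {ffun T -> C}}) :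
    (forall f g, g \in G -> f \in S -> [ffun v => f (g v)] \in S) ->
  \sum_(g in G) #|[set f in S | fixed_by g f]| =
  #|equivalence_partition
      (fun f f' => [exists g in G, f' == [ffun v => f (g v)]]) S| * #|G|.
Proof.
move=> S_stable.
have acts_S : [acts G, on S | precomp_action].
  apply/subsetP=> g Gg; rewrite inE in_setT; apply/andP; split=> //.
  by rewrite inE; apply/subsetP=> f Sf; rewrite inE; apply: S_stable; rewrite ?groupV.
transitivity (\sum_(g in G) #|'Fix_(S | precomp_action)[g]%g|).
  apply: eq_bigr => g Gg; apply: eq_card => f; rewrite !inE; congr (_ && _).
  rewrite sub1set inE; apply/fixed_byP/eqP => [fg | fg v].
    by apply/ffunP=> v; rewrite ffunE -{2}[v](permKV g) fg.
  by rewrite -{1}fg ffunE permK.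
rewrite (Frobenius_Cauchy acts_S); congr (#|pred_of_set _| * _).
apply: eq_in_imset => f Sf; apply/setP=> f'; rewrite !inE.
apply/orbitP/andP => [[g Gg <-] | [_ /exists_inP[g Gg /eqP->]]].
  split; first by apply: S_stable; rewrite ?groupV.
  by apply/exists_inP; exists g^-1%g; rewrite ?groupV.
by exists g^-1%g; rewrite ?groupV //; apply/ffunP=> v; rewrite !ffunE invgK.
Qed.

End Precomposition.

(** A function constant on the fibers of the surjection [p] descends to [E] in exactly one way. This
    turns colorings fixed by a permutation into arbitrary colorings of its set of cycles. *)
Lemma card_ffun_factor (D E C : finType) (p : D -> E)
    (Q : pred {ffun D -> C}) :
    (forall e, exists d, p d = e) ->
    (forall h, Q h -> forall x y, p x = p y -> h x = h y) ->
  #|[set h | Q h]| = #|[set u : {ffun E -> C} | Q [ffun x => u (p x)]]|.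
Proof.
move=> p_surj Qp.
pose F (u : {ffun E -> C}) : {ffun D -> C} := [ffun x => u (p x)].
have F_inj : injective F.
  move=> u v /ffunP eq_uv; apply/ffunP=> e; have [d <-] := p_surj e.
  by have:= eq_uv d; rewrite !ffunE.
rewrite -[RHS](card_imset _ F_inj); apply: eq_card => h.
rewrite inE; apply/idP/imsetP => [Qh | [u]]; last by rewrite inE => Qu ->.
have p_surjb e : exists d, p d == e by have [d <-] := p_surj e; exists d.
pose s e := xchoose (p_surjb e).
have sK e : p (s e) = e by apply/eqP/(xchooseP (p_surjb e)).
have Fh : h = F [ffun e => h (s e)].
  by apply/ffunP=> x; rewrite !ffunE; apply: (Qp h Qh); rewrite sK.
by exists [ffun e => h (s e)]; rewrite // inE -[X in Q X]Fh.
Qed.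

Section ImageIndex.
Variables (D T : finType) (F : D -> T).

(** Numbering the image by ordinals lets a set of cycles serve as a part of a smaller complete
    bipartite graph. *)
Definition image_index (x : D) : 'I_#|[set F x | x : D]| :=
  enum_rank_in (imset_f F (erefl : x \in D)) (F x).

Lemma image_index_val x : enum_val (image_index x) = F x.
Proof. by rewrite enum_rankK_in ?imset_f. Qed.

Lemma image_index_eq x y : (image_index x = image_index y) <-> (F x = F y).
Proof.
by split=> [eqxy | eqxy]; [rewrite -!image_index_val eqxy
  | apply: enum_val_inj; rewrite !image_index_val].
Qed.

Lemma image_index_surj e : exists x, image_index x = e.
Proof.
have /imsetP[x _ ex] := enum_valP e; exists x.
by apply: enum_val_inj; rewrite image_index_val ex.
Qed.

End ImageIndex.

(** * Permutations that keep or exchange the two parts *)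

Section SumPerm.
Variables m n : nat.

Definition sum_perm_fun (a : 'S_m) (b : 'S_n) (x : 'I_m + 'I_n) : 'I_m + 'I_n :=
  match x with inl i => inl (a i) | inr j => inr (b j) end.

Lemma sum_perm_inj a b : injective (sum_perm_fun a b).
Proof. by case=> x [] y //= [] /perm_inj->. Qed.

Definition sum_perm (a : 'S_m) (b : 'S_n) : {perm complete_bipartite m n} :=
  perm (@sum_perm_inj a b).

Lemma sum_permEl a b i : sum_perm a b (inl i) = inl (a i).
Proof. by rewrite permE. Qed.

Lemma sum_permEr a b j : sum_perm a b (inr j) = inr (b j).
Proof. by rewrite permE. Qed.

Definition sum_permE := (sum_permEl, sum_permEr).

End SumPerm.

Section SwapPerm.
Variable n : nat.

Definition swap_perm_fun (a b : 'S_n) (x : 'I_n + 'I_n) : 'I_n + 'I_n :=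
  match x with inl i => inr (a i) | inr j => inl (b j) end.

Lemma swap_perm_inj a b : injective (swap_perm_fun a b).
Proof. by case=> x [] y //= [] /perm_inj->. Qed.

Definition swap_perm (a b : 'S_n) : {perm complete_bipartite n n} :=
  perm (@swap_perm_inj a b).

Lemma swap_permEl a b i : swap_perm a b (inl i) = inr (a i).
Proof. by rewrite permE. Qed.

Lemma swap_permEr a b j : swap_perm a b (inr j) = inl (b j).
Proof. by rewrite permE. Qed.

Definition swap_permE := (swap_permEl, swap_permEr).

End SwapPerm.

(** * Colorings fixed by an automorphism *)

Lemma mu_proper_KP (m n lambda mu : nat)
    (f : coloring (complete_bipartite m n) lambda) :
  reflect (forall i j, f (inl i) = f (inr j) -> mu <= f (inl i))
          (mu_proper mu f).
Proof.
(* Since [color_of] adds one, a color exceeds [mu] iff its ordinal is at least [mu]. *)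
apply: (iffP forallP) => [fP i j eq_f | fP [] i].
- have /forallP/(_ (inr j)) := fP (inl i).
  by rewrite /= eq_f eqxx.
- apply/forallP=> -[] j //=; case: eqP => //= eq_f; exact: fP eq_f.
- apply/forallP=> -[] j //=; case: eqP => //= eq_f.
  by rewrite /color_of ltnS eq_f; apply: fP (esym eq_f).
Qed.

(** Collapsing each cycle of [a] and of [b] to a vertex gives a complete bipartite graph again.
    Every left cycle is joined to every right cycle, so properness transfers in both directions. *)
Lemma card_fixed_sum_perm (m n lambda mu : nat) (a : 'S_m) (b : 'S_n) :
  #|[set f in mu_proper_colorings (complete_bipartite m n) lambda mu
      | fixed_by (sum_perm a b) f]| =
  bichrom (complete_bipartite #|porbits a| #|porbits b|) lambda mu.
Proof.
pose ia := image_index (porbit a); pose ib := image_index (porbit b).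
pose p (x : complete_bipartite m n) :
    complete_bipartite #|porbits a| #|porbits b| :=
  match x with inl i => inl (ia i) | inr j => inr (ib j) end.
have p_surj e : exists d, p d = e.
  by case: e => e; have [x <-] := image_index_surj e; [exists (inl x) | exists (inr x)].
have porbit_step (k : nat) (s : 'S_k) x : porbit s (s x) = porbit s x.
  by have := porbit_perm s 1 x; rewrite expg1.
have p_stable x : p (sum_perm a b x) = p x.
  by case: x => x; rewrite sum_permE /p; [congr inl | congr inr];
    apply/image_index_eq; exact: porbit_step.
rewrite (card_ffun_factor p_surj) => [|h /andP[_ /fixed_byP h_fix]].
  rewrite /bichrom; apply: eq_card => u; rewrite !inE.
  have -> : fixed_by (sum_perm a b) [ffun x => u (p x)].
    by apply/fixed_byP=> x; rewrite !ffunE p_stable.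
  rewrite andbT; apply/mu_proper_KP/mu_proper_KP => uP i j.
    have [x <-] := image_index_surj i; have [y <-] := image_index_surj j.
    by have := uP x y; rewrite !ffunE.
  by rewrite !ffunE; apply: uP.
(* A fixed coloring restricts to a function on each part that is constant on cycles, hence it
   factors through [p]. *)
have h_fixl : fixed_by a [ffun i => h (inl i)].
  by apply/fixed_byP=> i; rewrite !ffunE -(h_fix (inl i)) sum_permE.
have h_fixr : fixed_by b [ffun j => h (inr j)].
  by apply/fixed_byP=> j; rewrite !ffunE -(h_fix (inr j)) sum_permE.
by case=> x [] y // [] /image_index_eq;
  [move/(fixed_by_porbit h_fixl) | move/(fixed_by_porbit h_fixr)]; rewrite !ffunE.
Qed.

Lemma card_ltn_ord (lambda mu : nat) : mu <= lambda ->
  #|[pred c : 'I_lambda | c < mu]| = mu.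
Proof.
by move=> le_mu; rewrite -sum1_card
  -(big_ord_widen _ (fun=> 1)) // sum_nat_const card_ord muln1.
Qed.

Lemma card_geq_ord (lambda mu : nat) : mu <= lambda ->
  #|[pred c : 'I_lambda | mu <= c]| = lambda - mu.
Proof.
move=> le_mu; rewrite -[X in X - _]card_ord -[X in _ - X](card_ltn_ord le_mu).
rewrite -(cardC [pred c : 'I_lambda | c < mu]) addKn.
by apply: eq_card => c; rewrite !inE -leqNgt.
Qed.

(** The square of the exchange acts on the left part as [a * b], and the color of a right vertex [j]
    is that of the left vertex [b j]. So a fixed coloring is a function on the cycles of [a * b],
    and each of its colors occurs on both parts. *)
Lemma card_fixed_swap_perm (n lambda mu : nat) (a b : 'S_n) :
    mu <= lambda ->
  #|[set f in mu_proper_colorings (complete_bipartite n n) lambda mu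
      | fixed_by (swap_perm a b) f]| =
  (lambda - mu) ^ #|porbits (a * b)%g|.
Proof.
move=> le_mu.
pose ix := image_index (porbit (a * b)%g).
pose p (x : complete_bipartite n n) : 'I_#|porbits (a * b)%g| :=
  match x with inl i => ix i | inr j => ix (b j) end.
have p_surj e : exists d, p d = e.
  by have [x <-] := image_index_surj e; exists (inl x).
have p_stable x : p (swap_perm a b x) = p x.
  case: x => x; rewrite swap_permE //=; apply/image_index_eq.
  by have := porbit_perm (a * b)%g 1 x; rewrite expg1 permM.
rewrite (card_ffun_factor p_surj) => [|h /andP[_ /fixed_byP h_fix]].
  rewrite -[X in _ ^ X]card_ord -(card_geq_ord le_mu) -card_ffun_on.
  apply: eq_card => u; rewrite !inE.
  have -> : fixed_by (swap_perm a b) [ffun x => u (p x)].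
    by apply/fixed_byP=> x; rewrite !ffunE p_stable.
  rewrite andbT; apply/mu_proper_KP/ffun_onP => [uP i | uP i j _].
    have [x <-] := image_index_surj i.
    (* The right vertex sent to [x] by [b] shares the color of the left vertex [x], which forces
       that color to be above [mu]. *)
    have := uP x ((b^-1)%g x); rewrite !ffunE /= permKV inE; exact.
  by rewrite ffunE; apply: uP.
have h_fixl : fixed_by (a * b)%g [ffun i => h (inl i)].
  apply/fixed_byP=> i; rewrite !ffunE permM -[RHS](h_fix (inl i)) swap_permE.
  by rewrite -(h_fix (inr _)) swap_permE.
have h_r j : h (inr j) = h (inl (b j)) by rewrite -(h_fix (inr j)) swap_permE.
by case=> x [] y /image_index_eq /(fixed_by_porbit h_fixl); rewrite !ffunE ?h_r.
Qed.

(** * Structure of the automorphism group *)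

Section BipartiteAut.
Variables m n : nat.

Lemma sum_perm_aut a b : sum_perm a b \in graph_aut (complete_bipartite m n).
Proof.
by rewrite inE; apply/forallP=> -[] x; apply/forallP=> -[] y; rewrite !sum_permE.
Qed.

Definition is_inl (x : complete_bipartite m n) : bool :=
  if x is inl _ then true else false.

Lemma adj_is_inl x y : adj x y = (is_inl x != is_inl y).
Proof. by case: x; case: y. Qed.

(** Adjacency means lying on different sides, so comparing [x] with the left vertex [i0] shows that
    the image of one vertex decides whether [g] keeps or exchanges the sides. *)
Lemma graph_aut_is_inl g (i0 : 'I_m) :
    g \in graph_aut (complete_bipartite m n) ->
  forall x, is_inl (g x) = (is_inl (g (inl i0)) == is_inl x).
Proof.
rewrite inE => /forallP g_aut x.
have /forallP/(_ x)/eqP := g_aut (inl i0); rewrite !adj_is_inl.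
by case: (is_inl (g _)); case: (is_inl (g x)); case: (is_inl x).
Qed.

Lemma graph_aut_sum_perm g (i0 : 'I_m) :
    g \in graph_aut (complete_bipartite m n) -> is_inl (g (inl i0)) ->
  exists a b, g = sum_perm a b.
Proof.
move=> g_aut g_i0.
have g_inl x : is_inl (g x) = is_inl x by rewrite (graph_aut_is_inl i0 g_aut) g_i0.
(* The [else] values are never taken, because [g] preserves sides. *)
pose a i := if g (inl i) is inl i' then i' else i.
pose b j := if g (inr j) is inr j' then j' else j.
have aE i : g (inl i) = inl (a i) by rewrite /a; have := g_inl (inl i); case: (g _).
have bE j : g (inr j) = inr (b j) by rewrite /b; have := g_inl (inr j); case: (g _).
have a_inj : injective a.
  by move=> x y eq_a; have /perm_inj[] : g (inl x) = g (inl y) by rewrite !aE eq_a.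
have b_inj : injective b.
  by move=> x y eq_b; have /perm_inj[] : g (inr x) = g (inr y) by rewrite !bE eq_b.
exists (perm a_inj), (perm b_inj); apply/permP=> -[] x.
  by rewrite sum_permE permE aE.
by rewrite sum_permE permE bE.
Qed.

Lemma sum_graph_aut_keep (i0 : 'I_m) (F : {perm complete_bipartite m n} -> nat) :
  \sum_(g in graph_aut (complete_bipartite m n) | is_inl (g (inl i0))) F g =
  \sum_(a : 'S_m) \sum_(b : 'S_n) F (sum_perm a b).
Proof.
rewrite pair_big /=; pose h (ab : 'S_m * 'S_n) := sum_perm ab.1 ab.2.
have h_inj : injective h.
  move=> [a b] [a' b'] /permP eq_h; congr (_, _); apply/permP=> x.
    by have := eq_h (inl x); rewrite !sum_permE => -[].
  by have := eq_h (inr x); rewrite !sum_permE => -[].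
rewrite -(big_imset F (in2W h_inj)); apply: eq_bigl => g.
apply/andP/imsetP => [[g_aut g_i0] | [[a b] _ ->]].
  by have [a [b ->]] := graph_aut_sum_perm g_aut g_i0; exists (a, b).
by rewrite sum_perm_aut sum_permE.
Qed.

(** Such a [g] exchanges the sides everywhere and is a bijection, so both sides have equally many
    vertices; the proof reindexes the count of left vertices along [g]. *)
Lemma graph_aut_swap_eq g (i0 : 'I_m) :
  g \in graph_aut (complete_bipartite m n) -> ~~ is_inl (g (inl i0)) -> m = n.
Proof.
move=> g_aut /negbTE g_i0.
have sum_inl : \sum_(x : complete_bipartite m n) is_inl x = m.
  rewrite big_sumType /= [X in _ + X]big1 // addn0.
  by rewrite sum_nat_const card_ord muln1.
have sum_inr : \sum_(x : complete_bipartite m n) ~~ is_inl x = n.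
  by rewrite big_sumType /= big1 // add0n sum_nat_const card_ord muln1.
rewrite -sum_inl -[RHS]sum_inr (reindex_inj (@perm_inj _ g)).
apply: eq_bigr => x _.
by rewrite (graph_aut_is_inl i0 g_aut) g_i0; case: is_inl.
Qed.

End BipartiteAut.

Lemma sum_graph_aut_neq (m n : nat) (F : {perm complete_bipartite m n} -> nat) :
    0 < m -> m <> n ->
  \sum_(g in graph_aut (complete_bipartite m n)) F g =
  \sum_(a : 'S_m) \sum_(b : 'S_n) F (sum_perm a b).
Proof.
move=> m_gt0 neq_mn; rewrite -(sum_graph_aut_keep (Ordinal m_gt0)).
apply: eq_bigl => g; case g_aut: (g \in _) => //=.
by apply/esym/negPn/negP => /(graph_aut_swap_eq g_aut).
Qed.

Section BalancedAut.
Variable n : nat.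

Lemma swap_perm_aut a b : swap_perm a b \in graph_aut (complete_bipartite n n).
Proof.
by rewrite inE; apply/forallP=> -[] x; apply/forallP=> -[] y; rewrite !swap_permE.
Qed.

Lemma sum_permM_swap a b :
  (sum_perm a b * swap_perm 1 1)%g = swap_perm a b :> {perm complete_bipartite n n}.
Proof.
by apply/permP=> -[] x; rewrite permM sum_permE !swap_permE perm1.
Qed.

(** The automorphisms that exchange the sides form the coset of the side-preserving ones by the
    plain exchange [swap_perm 1 1]. *)
Lemma sum_graph_aut_eq (F : {perm complete_bipartite n n} -> nat) :
    0 < n ->
  \sum_(g in graph_aut (complete_bipartite n n)) F g =
  \sum_(a : 'S_n) \sum_(b : 'S_n) F (sum_perm a b) +
  \sum_(a : 'S_n) \sum_(b : 'S_n) F (swap_perm a b).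
Proof.
move=> n_gt0; pose i0 := Ordinal n_gt0.
rewrite (bigID (fun g : {perm complete_bipartite n n} => is_inl (g (inl i0)))) /=.
rewrite (sum_graph_aut_keep i0); congr (_ + _).
under [RHS]eq_bigr => a _ do under eq_bigr => b _ do rewrite -sum_permM_swap.
rewrite -(sum_graph_aut_keep i0 (fun g => F (g * swap_perm 1 1)%g)).
rewrite (reindex_inj (mulIg (swap_perm 1 1 : {perm complete_bipartite n n}))) /=.
apply: eq_bigl => g.
have swapG : swap_perm 1 1 \in graph_aut_group (complete_bipartite n n).
  exact: swap_perm_aut.
rewrite (groupMr g swapG); congr (_ && _); rewrite permM.
by case: (g _) => x; rewrite swap_permE.
Qed.

End BalancedAut.

(** * Orbits of functions under the symmetric group *)

Lemma card_imset_kernel (T A B : finType) (f : T -> A) (g : T -> B)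
    (S : {pred T}) :
    {in S &, forall x y, f x = f y <-> g x = g y} ->
  #|[set f x | x in S]| = #|[set g x | x in S]|.
Proof.
have le_card (A' B' : finType) (f' : T -> A') (g' : T -> B') :
    {in S &, forall x y, g' x = g' y -> f' x = f' y} ->
  #|[set f' x | x in S]| <= #|[set g' x | x in S]|.
  (* [h] sends a value of [g'] to the value of [f'] at a chosen preimage, and is [None] off the
     image. Hence the image of [f'], embedded by [Some], lies in the image of [h]. *)
  move=> ker_le; pose h b := omap f' [pick x in S | g' x == b].
  have Some_injA : injective (@Some A') by move=> a b [].
  rewrite -(card_imset _ Some_injA).
  apply: leq_trans (leq_imset_card h _); apply/subset_leq_card/subsetP.
  move=> _ /imsetP[_ /imsetP[x Sx ->] ->]; apply/imsetP.
  exists (g' x); first exact: imset_f.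
  rewrite /h; case: pickP => [y /andP[Sy /eqP eq_g] | /(_ x)] /=.
    by congr Some; apply: ker_le.
  by rewrite [x \in S]Sx eqxx.
by move=> ker_eq; apply/eqP; rewrite eqn_leq !le_card // => x y Sx Sy /ker_eq->.
Qed.

(** The sorted list encodes the multiset of values, a complete invariant of [f] up to permuting its
    arguments. *)
Definition sorted_values (n x : nat) (f : {ffun 'I_n -> 'I_x}) : n.-tuple 'I_x :=
  sort_tuple (relpre val leq) [tuple f i | i < n].

Lemma sorted_values_eq (n x : nat) (f f' : {ffun 'I_n -> 'I_x}) :
  reflect (exists g : 'S_n, f' = [ffun i => f (g i)])
          (sorted_values f == sorted_values f').
Proof.
have leT_total : total (relpre (val : 'I_x -> nat) leq) by move=> i j; apply: leq_total.
have leT_trans : transitive (relpre (val : 'I_x -> nat) leq).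
  by move=> i j k; apply: leq_trans.
have leT_anti : antisymmetric (relpre (val : 'I_x -> nat) leq).
  by move=> i j /anti_leq /val_inj.
have -> : (sorted_values f == sorted_values f') =
    perm_eq [tuple f' i | i < n] [tuple f i | i < n].
  rewrite perm_sym; apply/eqP/(perm_sortP leT_total leT_trans leT_anti).
    exact: (congr1 val).
  by move=> eq_sort; apply: val_inj.
apply: (iffP tuple_permP) => -[g eq_g]; exists g.
  apply/ffunP=> i; have /(congr1 (fun t => tnth t i)) : [tuple f' i | i < n] = _ :=
    val_inj eq_g.
  by rewrite !tnth_mktuple ffunE.
by congr val; apply: eq_from_tnth => i; rewrite !tnth_mktuple eq_g ffunE.
Qed.

Lemma card_sorted_values (n x : nat) :
    0 < n ->
  #|[set sorted_values f | f in [set: {ffun 'I_n -> 'I_x}]]| = 'C(n + x - 1, n).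
Proof.
move=> n_gt0; case: x => [|x].
  (* Without colors there is no tuple of positive length, and the binomial has upper index
     [n - 1]. *)
  rewrite bin_small; last by rewrite addn0 subn1 prednK.
  apply/eqP; rewrite cards_eq0; apply/eqP/setP=> t; rewrite inE.
  by have [] := tnth t (Ordinal n_gt0).
rewrite addnS subn1 /= -card_sorted_tuples; apply: eq_card => t; rewrite inE.
rewrite sorted_map; apply/imsetP/idP => [[f _ ->] | t_sorted].
  by apply: sort_sorted => i j; apply: leq_total.
pose f : {ffun 'I_n -> 'I_x.+1} := [ffun i => tnth t i].
have fE : [tuple f i | i < n] = t.
  by apply: eq_from_tnth => i; rewrite tnth_mktuple ffunE.
exists f; first by rewrite inE.
apply: val_inj; rewrite /sorted_values fE /= sorted_sort //.
by move=> i j k; apply: leq_trans.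
Qed.

Lemma card_fixed_by (n x : nat) (s : 'S_n) :
  #|[set f : {ffun 'I_n -> 'I_x} in setT | fixed_by s f]| = x ^ #|porbits s|.
Proof.
rewrite (card_ffun_factor (@image_index_surj _ _ (porbit s))).
  rewrite -[x in RHS]card_ord -[X in _ ^ X]card_ord -card_ffun.
  apply: eq_card => u; rewrite !inE; apply/fixed_byP=> i; rewrite !ffunE.
  congr (u _); apply/image_index_eq.
  by have := porbit_perm s 1 i; rewrite expg1.
by move=> h /andP[_ h_fix] i j /image_index_eq; apply: fixed_by_porbit.
Qed.

(** Burnside for the symmetric group acting on functions to ['I_x]: the summand counts the functions
    fixed by [s], and the orbits are the multisets of [n] colors. *)
Lemma sum_expn_porbits (n x : nat) : 0 < n ->
  \sum_(s : 'S_n) x ^ #|porbits s| = 'C(n + x - 1, n) * n`!.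
Proof.
move=> n_gt0; rewrite -card_sorted_values //.
transitivity (\sum_(s in [set: 'S_n])
    #|[set f : {ffun 'I_n -> 'I_x} in setT | fixed_by s f]|).
  by apply: eq_big => s; rewrite ?inE // card_fixed_by.
rewrite burnside_precomp // cardsT card_Sn; congr (_ * _).
set R := (X in equivalence_partition X).
have RP f f' : reflect (sorted_values f = sorted_values f') (R f f').
  apply: (iffP exists_inP) => [[g _ /eqP f'E] | /eqP/sorted_values_eq[g f'E]].
    by apply/eqP/sorted_values_eq; exists g.
  by exists g; rewrite ?inE // f'E.
apply: card_imset_kernel => f f' _ _; split=> [/setP/(_ f') | eq_ff'].
  by rewrite !inE (introT (RP f' f') erefl) => /RP.
by apply/setP=> h; rewrite !inE; apply/RP/RP; rewrite eq_ff'.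
Qed.

(** * Grouping by cycles and by blocks: Stirling numbers *)

Lemma sum_by_value (I : finType) (P : pred I) (c : I -> nat) (G : nat -> nat)
    (N : nat) :
    (forall x, P x -> c x <= N) ->
  \sum_(x | P x) G (c x) =
  \sum_(0 <= i < N.+1) #|[set x | P x && (c x == i)]| * G i.
Proof.
move=> c_le; rewrite big_mkord.
rewrite (partition_big (fun x => inord (c x) : 'I_N.+1) xpredT) //=.
apply: eq_bigr => i _.
have inordE x : P x && (inord (c x) == i) = P x && (c x == i).
  by case Px: (P x) => //=; rewrite -val_eqE /= inordK // ltnS c_le.
rewrite (eq_bigl _ _ inordE) -sum1dep_card big_distrl /=.
by apply: eq_bigr => x /andP[_ /eqP->]; rewrite mul1n.
Qed.

Lemma sum_porbits (n : nat) (G : nat -> nat) :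
  \sum_(s : 'S_n) G #|porbits s| = \sum_(0 <= k < n.+1) stirling1 n k * G k.
Proof.
rewrite (@sum_by_value _ _ _ _ n) // => s _.
by rewrite -[n in leqRHS]card_ord; apply: leq_imset_card.
Qed.

Section Preimage.
Variables D T : finType.
Implicit Types (P : {set {set D}}) (h : D -> T).

Lemma card_pblocks P :
  partition P [set: D] -> #|[set pblock P x | x : D]| = #|P|.
Proof.
move=> partP; rewrite -[X in _ = #|pred_of_set X|](preim_partition_pblock partP).
transitivity #|[set pblock P x | x in [set: D]]|.
  by apply: eq_card => B; apply/imsetP/imsetP => -[x _ ->]; exists x; rewrite ?inE.
apply: card_imset_kernel => x y _ _; split=> [eq_xy | /setP/(_ y)].
  by apply/setP=> z; rewrite !inE eq_xy.
by rewrite !inE eqxx => /eqP.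
Qed.

Lemma preim_partition_eqP P h :
    partition P [set: D] ->
  reflect (forall x y, h x = h y <-> pblock P x = pblock P y)
          (preim_partition h [set: D] == P).
Proof.
move=> partP; apply: (iffP eqP) => [hP x y | ker_h].
  have /and3P[/eqP covP trivP _] := partP.
  have : (pblock P x == pblock P y) = (h x == h y).
    rewrite eq_pblock ?covP ?inE // -hP pblock_equivalence_partition ?inE //.
    by move=> u v w _ _ _; split=> // /eqP->.
  by move=> eq_b; split=> /eqP; [rewrite -eq_b | rewrite eq_b] => /eqP.
rewrite -[RHS](preim_partition_pblock partP); apply: eq_imset => x.
by apply/setP=> y; rewrite !inE; apply/eqP/eqP=> /ker_h.
Qed.

Lemma card_preim_partition h :
  #|preim_partition h [set: D]| = #|[set h x | x in [set: D]]|.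
Proof.
apply: card_imset_kernel => x y _ _; split=> [/setP/(_ y) | eq_xy].
  by rewrite !inE eqxx => /eqP.
by apply/setP=> z; rewrite !inE eq_xy.
Qed.

(** A function whose fibers are exactly the blocks of [P] is an injection from the blocks into
    [M]. *)
Lemma card_ffun_preim_partition P (M : pred T) :
    partition P [set: D] ->
  #|[set h : {ffun D -> T} | (h \in ffun_on M) && (preim_partition h [set: D] == P)]|
    = #|M| ^_ #|P|.
Proof.
move=> partP.
rewrite (card_ffun_factor (@image_index_surj _ _ (pblock P))); last first.
  move=> h /andP[_ /(preim_partition_eqP _ partP) ker_h] x y /image_index_eq.
  by move/ker_h.
rewrite -[X in _ = _ ^_ X]card_pblocks // -[X in _ = _ ^_ X]card_ord.
rewrite -card_inj_ffuns_on; apply: eq_card => u; rewrite !inE; congr (_ && _).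
  apply/ffun_onP/ffun_onP => uM e; last by rewrite ffunE.
  by have [x <-] := image_index_surj e; have := uM x; rewrite ffunE.
apply/(preim_partition_eqP _ partP)/injectiveP => [ker_u e e' | u_inj x y].
  have [x <-] := image_index_surj e; have [y <-] := image_index_surj e'.
  by move=> eq_u; apply/image_index_eq/ker_u; rewrite !ffunE.
rewrite !ffunE; split=> [/u_inj/image_index_eq // | eq_b].
by congr (u _); apply/image_index_eq.
Qed.

End Preimage.

(** Group the functions by their fiber partition: the image has as many elements as there are
    blocks, and each partition into [j] blocks carries [#|M| ^_ j] functions. *)
Lemma sum_card_image (i : nat) (T : finType) (M : pred T) (w : nat -> nat) :
  \sum_(h : {ffun 'I_i -> T} | h \in ffun_on M) w #|[set h x | x in [set: 'I_i]]| =
  \sum_(0 <= j < i.+1) stirling2 i j * (#|M| ^_ j * w j).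
Proof.
rewrite (partition_big (fun h : {ffun 'I_i -> T} => preim_partition h [set: 'I_i])
           (fun P => partition P [set: 'I_i])) /= => [|h _]; last first.
  exact: preim_partitionP.
rewrite -(@sum_by_value _ _ _ (fun j => #|M| ^_ j * w j)); last first.
  move=> P partP; rewrite -card_pblocks // -[X in _ <= X]card_ord.
  exact: leq_imset_card.
apply: eq_bigr => P partP; rewrite -card_ffun_preim_partition //.
rewrite -sum1dep_card big_distrl /=; apply: eq_bigr => h /andP[_ /eqP hP].
by rewrite mul1n -card_preim_partition hP.
Qed.

(** * Counting the colorings of a complete bipartite graph *)

Section ColorCount.
Variables (k lambda mu : nat).
Hypothesis le_mu : mu <= lambda.

Let low (f : {ffun 'I_k -> 'I_lambda}) := [set i | f i < mu].

(** On [A] the coloring is prescribed by [h]; each vertex outside [A] chooses freely among the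
    [lambda - mu] colors above [mu]. *)
Lemma card_low_extension (A : {set 'I_k}) (h : {ffun 'I_#|A| -> 'I_lambda}) :
    h \in ffun_on [pred c : 'I_lambda | c < mu] ->
  #|[set f | (low f == A) && ([ffun i => f (enum_val i)] == h)]| =
  (lambda - mu) ^ (k - #|A|).
Proof.
move=> /ffun_onP hM.
(* The second condition pins the color on [A] and is vacuous outside, so the admissible colorings
   form a product of independent choices. *)
pose F (x : 'I_k) := [pred c : 'I_lambda | ((c < mu) == (x \in A)) &&
  [forall i, (enum_val i == x) ==> (c == h i)]].
have FA x : x \in A -> #|F x| = 1.
  move=> Ax; pose i := enum_rank_in Ax x.
  have ix : enum_val i = x by rewrite enum_rankK_in.
  rewrite -(card1 (h i)); apply: eq_card => c; rewrite !inE Ax.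
  apply/andP/eqP => [[_ /forallP/(_ i)] | ->].
    by rewrite ix eqxx => /eqP.
  split; first by rewrite eqb_id; apply: hM.
  by apply/forallP=> j; apply/implyP; rewrite -ix => /eqP/enum_val_inj->.
have FC x : x \notin A -> #|F x| = lambda - mu.
  move=> Ax; rewrite -(card_geq_ord le_mu); apply: eq_card => c; rewrite !inE.
  rewrite (negbTE Ax) eqbF_neg -leqNgt andb_idr // => _.
  apply/forallP=> i; apply/implyP=> /eqP ix.
  by rewrite -ix enum_valP in Ax.
transitivity #|family F|.
  apply: eq_card => f; rewrite !inE.
  apply/andP/familyP => [[/eqP fA /eqP/ffunP fh] x | fF].
    have Ax : (x \in A) = (f x < mu) by rewrite -fA inE.
    rewrite !inE Ax eqxx; apply/forallP=> i.
    by apply/implyP=> /eqP <-; rewrite -fh ffunE.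
  split; [apply/eqP/setP=> x | apply/eqP/ffunP=> i].
    by have := fF x; rewrite !inE => /andP[/eqP].
  rewrite ffunE; have := fF (enum_val i); rewrite !inE => /andP[_ /forallP/(_ i)].
  by rewrite eqxx => /eqP.
rewrite card_family foldrE big_image /= (bigID (mem A)) /=.
rewrite big1 ?mul1n; last exact: FA.
rewrite (eq_bigr (fun=> lambda - mu)); last exact: FC.
by rewrite prod_nat_const -[X in _ ^ (X - _)]card_ord -(cardC A) addKn.
Qed.

(** Classify [f] first by the set [A] of its low vertices, then by its restriction to [A]. The image
    of [low f] is the image of that restriction, to which [sum_card_image] applies. *)
Lemma sum_card_low_image (w : nat -> nat) :
  \sum_(f : {ffun 'I_k -> 'I_lambda}) w #|f @: low f| =
  \sum_(0 <= i < k.+1) 'C(k, i) * ((lambda - mu) ^ (k - i) *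
    \sum_(0 <= j < i.+1) stirling2 i j * (mu ^_ j * w j)).
Proof.
pose G i := (lambda - mu) ^ (k - i) *
  \sum_(0 <= j < i.+1) stirling2 i j * (mu ^_ j * w j).
transitivity (\sum_(A : {set 'I_k}) G #|A|); last first.
  rewrite (@sum_by_value _ _ _ _ k) => [|A _]; last first.
    by rewrite -[X in _ <= X]card_ord max_card.
  apply: eq_bigr => i _; congr (_ * _).
  by rewrite -[X in 'C(X, _)]card_ord -card_draws.
rewrite (partition_big low xpredT) //=; apply: eq_bigr => A _.
pose res (f : {ffun 'I_k -> 'I_lambda}) := [ffun i : 'I_#|A| => f (enum_val i)].
rewrite (partition_big res (mem (ffun_on [pred c : 'I_lambda | c < mu]))) /=;
    last first.
  move=> f /eqP/setP fA; apply/ffun_onP=> i; rewrite ffunE.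
  by have := fA (enum_val i); rewrite !inE enum_valP.
have := sum_card_image #|A| [pred c : 'I_lambda | c < mu] w.
rewrite (card_ltn_ord le_mu) /G => <-; rewrite big_distrr /=.
apply: eq_bigr => h hM; rewrite -(card_low_extension hM) -sum1dep_card.
rewrite big_distrl /=; apply: eq_bigr => f /andP[/eqP-> /eqP <-].
rewrite mul1n; congr (w #|pred_of_set _|); apply/setP=> c.
apply/imsetP/imsetP => [[x Ax ->] | [i _ ->]].
  by exists (enum_rank_in Ax x); rewrite ?inE // ffunE enum_rankK_in.
by exists (enum_val i); rewrite ?ffunE ?enum_valP.
Qed.

(** Once the left part is colored by [f], the right vertices are independent, and each has only to
    avoid the low colors used by [f]. *)
Lemma bichrom_sum (l : nat) :
  bichrom (complete_bipartite k l) lambda mu =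
  \sum_(f : {ffun 'I_k -> 'I_lambda}) (lambda - #|f @: low f|) ^ l.
Proof.
rewrite /bichrom -sum1_card.
pose res (g : coloring (complete_bipartite k l) lambda) :=
  [ffun i => g (inl i)] : {ffun 'I_k -> 'I_lambda}.
rewrite (partition_big res xpredT) //=; apply: eq_bigr => f _.
pose F (x : complete_bipartite k l) : pred 'I_lambda :=
  if x is inl i then pred1 (f i) else [pred c | c \notin f @: low f].
transitivity #|family F|.
  rewrite sum1dep_card; apply: eq_card => g; rewrite !inE.
  apply/andP/familyP => [[/mu_proper_KP gP /eqP/ffunP fE] x | gF].
    have gl i : f i = g (inl i) by rewrite -fE ffunE.
    case: x => [i | j]; rewrite inE ?gl //.
    apply/imsetP=> -[i]; rewrite !inE gl ltnNge => low_i /esym/gP.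
    exact/negP.
  have gl i : g (inl i) = f i by apply/eqP; have := gF (inl i).
  split; last by apply/eqP/ffunP=> i; rewrite ffunE gl.
  apply/mu_proper_KP=> i j; rewrite gl leqNgt => eq_fg.
  apply: contraL (gF (inr j)) => low_i; rewrite inE negbK -eq_fg.
  by apply: imset_f; rewrite inE.
have cardF j : #|F (inr j)| = lambda - #|f @: low f|.
  by rewrite -[X in X - _]card_ord -(cardC (f @: low f)) addKn.
rewrite card_family foldrE big_image big_sumType /= big1 ?mul1n => [|i _].
  by rewrite (eq_bigr _ (fun j _ => cardF j)) prod_nat_const card_ord.
exact: card1.
Qed.

Lemma bichrom_complete_bipartite (l : nat) :
  bichrom (complete_bipartite k l) lambda mu =
  \sum_(0 <= i < k.+1) 'C(k, i) * ((lambda - mu) ^ (k - i) *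
    \sum_(0 <= j < i.+1) stirling2 i j * (mu ^_ j * (lambda - j) ^ l)).
Proof. by rewrite bichrom_sum (sum_card_low_image (fun j => (lambda - j) ^ l)). Qed.

End ColorCount.

(** * Orbit counts in natural numbers *)

Lemma mu_proper_precomp (Gamma : sgraph) (lambda mu : nat)
    (f : coloring Gamma lambda) (g : {perm Gamma}) :
    g \in graph_aut Gamma -> f \in mu_proper_colorings Gamma lambda mu ->
  [ffun v => f (g v)] \in mu_proper_colorings Gamma lambda mu.
Proof.
rewrite !inE => /forallP g_aut /forallP fP.
apply/forallP=> v; apply/forallP=> w; rewrite !ffunE.
have /forallP/(_ w)/eqP <- := g_aut v.
by have /forallP/(_ (g w)) := fP (g v).
Qed.

Lemma orbital_bichrom_aut (Gamma : sgraph) (lambda mu : nat) :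
  orbital_bichrom (graph_aut_group Gamma) lambda mu * #|graph_aut Gamma| =
  \sum_(g in graph_aut Gamma)
    #|[set f in mu_proper_colorings Gamma lambda mu | fixed_by g f]|.
Proof.
rewrite (burnside_precomp (G := graph_aut_group Gamma)) // => f g.
exact: mu_proper_precomp.
Qed.

Lemma sum_fixed_sum_perm (m n lambda mu : nat) :
  \sum_(a : 'S_m) \sum_(b : 'S_n)
    #|[set f in mu_proper_colorings (complete_bipartite m n) lambda mu
        | fixed_by (sum_perm a b) f]| =
  \sum_(0 <= k < m.+1) \sum_(0 <= l < n.+1)
    stirling1 m k * stirling1 n l * bichrom (complete_bipartite k l) lambda mu.
Proof.
pose B k l := bichrom (complete_bipartite k l) lambda mu.
transitivity (\sum_(a : 'S_m) \sum_(0 <= l < n.+1) stirling1 n l * B #|porbits a| l).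
  apply: eq_bigr => a _; rewrite -sum_porbits.
  by apply: eq_bigr => b _; rewrite card_fixed_sum_perm.
rewrite (sum_porbits m (fun k => \sum_(0 <= l < n.+1) stirling1 n l * B k l)).
by apply: eq_bigr => k _; rewrite big_distrr; apply: eq_bigr => l _; rewrite /= mulnA.
Qed.

(** For fixed [a], the product [a * b] runs once through the symmetric group, so the inner sum does
    not depend on [a]. *)
Lemma sum_fixed_swap_perm (n lambda mu : nat) : 0 < n -> mu <= lambda ->
  \sum_(a : 'S_n) \sum_(b : 'S_n)
    #|[set f in mu_proper_colorings (complete_bipartite n n) lambda mu
        | fixed_by (swap_perm a b) f]| =
  n`! * (n`! * 'C(n + lambda - mu - 1, n)).
Proof.
move=> n_gt0 le_mu.
transitivity (\sum_(a : 'S_n) n`! * 'C(n + lambda - mu - 1, n)); last first.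
  by rewrite sum_nat_const card_Sn.
apply: eq_bigr => a _; rewrite mulnC -addnBA // -sum_expn_porbits //.
rewrite [RHS](reindex_inj (mulgI a)); apply: eq_bigr => b _.
exact: card_fixed_swap_perm.
Qed.

Lemma card_perm_pairs (m n : nat) : \sum_(a : 'S_m) \sum_(b : 'S_n) 1 = m`! * n`!.
Proof.
by rewrite sum_nat_const [X in _ * X]sum_nat_const muln1 !card_Sn.
Qed.

Lemma orbital_bichrom_neq (m n lambda mu : nat) : 0 < m -> m <> n ->
  orbital_bichrom (graph_aut_group (complete_bipartite m n)) lambda mu *
    (m`! * n`!) =
  \sum_(0 <= k < m.+1) \sum_(0 <= l < n.+1)
    stirling1 m k * stirling1 n l * bichrom (complete_bipartite k l) lambda mu.
Proof.
move=> m_gt0 neq_mn; have := orbital_bichrom_aut (complete_bipartite m n) lambda mu.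
(* The order of the group is computed by the same decomposition, applied to the constant 1. *)
rewrite -sum1_card !sum_graph_aut_neq // card_perm_pairs => ->.
exact: sum_fixed_sum_perm.
Qed.

Lemma orbital_bichrom_eq (n lambda mu : nat) : 0 < n -> mu <= lambda ->
  orbital_bichrom (graph_aut_group (complete_bipartite n n)) lambda mu *
    (2 * n`! * n`!) =
  \sum_(0 <= k < n.+1) \sum_(0 <= l < n.+1)
    stirling1 n k * stirling1 n l * bichrom (complete_bipartite k l) lambda mu
  + n`! * (n`! * 'C(n + lambda - mu - 1, n)).
Proof.
move=> n_gt0 le_mu; have := orbital_bichrom_aut (complete_bipartite n n) lambda mu.
rewrite -sum1_card !sum_graph_aut_eq // card_perm_pairs addnn -mul2n [2 * _]mulnA => ->.
by rewrite sum_fixed_sum_perm sum_fixed_swap_perm.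
Qed.

(** * Passage to rational numbers *)

Local Open Scope ring_scope.

Theorem theorem7 (m n lambda mu : nat)
    (m_gt0 : (0 < m)%N) (n_gt0 : (0 < n)%N) (lambda_gt0 : (0 < lambda)%N)
    (mu_le : (mu <= lambda)%N) :
  (m <> n ->
     (orbital_bichrom (graph_aut_group (complete_bipartite m n)) lambda mu)%:R =
     ((m`!)%:R * (n`!)%:R)^-1 *
       \sum_(0 <= k < m.+1) \sum_(0 <= l < n.+1)
         (stirling1 m k)%:R * (stirling1 n l)%:R *
         (bichrom (complete_bipartite k l) lambda mu)%:R :> rat)
  /\
  (orbital_bichrom (graph_aut_group (complete_bipartite n n)) lambda mu)%:R =
     (2%:R * (n`!)%:R * (n`!)%:R)^-1 *
       (\sum_(0 <= k < n.+1) \sum_(0 <= l < n.+1)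
         (stirling1 n k)%:R * (stirling1 n l)%:R *
         (bichrom (complete_bipartite k l) lambda mu)%:R)
     + 2%:R^-1 * ('C((n + lambda - mu - 1)%N, n))%:R :> rat
  /\
  (forall k l : nat,
     (bichrom (complete_bipartite k l) lambda mu)%:R =
     \sum_(0 <= i < k.+1)
       ('C(k, i))%:R * (lambda%:R - mu%:R) ^+ (k - i)%N *
       \sum_(0 <= j < i.+1)
         (stirling2 i j)%:R * (lambda%:R - j%:R) ^+ l * (mu ^_ j)%:R :> rat).
Proof.
have fact_neq0 p : (p`!)%:R != 0 :> rat by rewrite Num.Theory.pnatr_eq0 -lt0n fact_gt0.
split; [|split].
- move=> neq_mn.
  have nat_id := orbital_bichrom_neq lambda mu m_gt0 neq_mn.
  apply: (@mulfI _ ((m`!)%:R * (n`!)%:R)); first by rewrite mulf_neq0.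
  rewrite mulVKf ?mulf_neq0 // mulrC -!natrM nat_id natr_sum.
  apply: eq_bigr => k _; rewrite natr_sum; apply: eq_bigr => l _.
  by rewrite !natrM.
- have nat_id := orbital_bichrom_eq n_gt0 mu_le.
  have two_neq0 : 2%:R != 0 :> rat by [].
  have den_neq0 : 2%:R * (n`!)%:R * (n`!)%:R != 0 :> rat by rewrite !mulf_neq0.
  apply: (mulfI den_neq0); rewrite mulrDr mulVKf //.
  rewrite [X in _ + X](_ : _ = (n`! * (n`! * 'C(n + lambda - mu - 1, n)))%:R);
    last first.
    by rewrite !natrM -(mulrA 2%:R) -mulrA [X in _ * X]mulrCA mulVKf // mulrA.
  rewrite mulrC -!natrM nat_id natrD; congr (_ + _); rewrite natr_sum.
  apply: eq_bigr => k _; rewrite natr_sum; apply: eq_bigr => l _.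
  by rewrite !natrM.
- move=> k l; rewrite (bichrom_complete_bipartite k mu_le) natr_sum.
  apply: eq_bigr => i _; rewrite !natrM natrX natrB // mulrA; congr (_ * _).
  rewrite natr_sum; apply: eq_bigr => j _; rewrite !natrM natrX.
  (* Natural subtraction [lambda - j] agrees with the rational one when [j <= mu]; beyond [mu] the
     falling factorial vanishes. *)
  have [le_j | lt_j] := leqP j mu; last by rewrite ffact_small // mul0r !mulr0.
  by rewrite natrB ?(leq_trans le_j) // mulrA mulrAC.
Qed.
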